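(* Let $R$ be a principal ideal domain and let $f=\sum_i f_iX^i\in R[X]$. Then $f$ is irreducible in $R[[X]]$ if and only if one of the following conditions holds: (1) $f_0=0$ and $f_1$ is a unit in $R$; (2) $f_0$ is associate in $R$ to $\pi^m$ for some prime element $\pi\in R$ and some integer $m\ge 1$, and whenever $f=gh$ with $g,h\in\widehat{R}_{(\pi)}[X]$, either $g_0$ or $h_0$ is a unit in $\widehat{R}_{(\pi)}$.
   Context: For a polynomial or power series $f$, $f_i$ denotes the coefficient of $X^i$. A nonzero element $a$ of a ring is prime if $(a)$ is a prime ideal. For an ideal $\mathfrak a$ of a ring $R$, $\widehat{R}_{\mathfrak a}=\varprojlim R/\mathfrak a^n$ denotes the $\mathfrak a$-adic completion; thus $\widehat{R}_{(\pi)}$ is the $\pi$-adic completion of $R$, and $R[X]\subseteq \widehat{R}_{(\pi)}[X]$ via the canonical map. *)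

(* Defs.v *)
From HB Require Import structures.
From mathcomp Require Import all_boot all_order all_algebra.
Set Implicit Arguments. Unset Strict Implicit. Unset Printing Implicit Defensive.
Import Order.TTheory GRing.Theory Num.Theory.
Local Open Scope ring_scope.

Section Defs.
Variable R : idomainType.

Definition dvdR (a b : R) : Prop := exists c : R, b = c * a.

Definition is_ideal (I : R -> Prop) : Prop :=
  [/\ I 0, (forall x y, I x -> I y -> I (x + y)) & (forall r x, I x -> I (r * x))].
Definition is_principal (I : R -> Prop) : Prop :=
  exists a : R, forall x, I x <-> dvdR a x.
Definition PID : Prop := forall I, is_ideal I -> is_principal I.

Definition prime_elt (p : R) : Prop :=
  [/\ p != 0, p \isn't a GRing.unit &
      (forall x y, dvdR p (x * y) -> dvdR p x \/ dvdR p y)].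

Definition pser := nat -> R.
Definition ps_mul (g h : pser) : pser :=
  fun k => \sum_(i < k.+1) g i * h (k - i)%N.
Definition ps_one : pser := fun k => (k == 0%N)%:R.
Definition ps_unit (g : pser) : Prop :=
  exists h : pser, forall k, ps_mul g h k = ps_one k.
Definition ps_irreducible (f : pser) : Prop :=
  [/\ exists k, f k != 0, ~ ps_unit f &
      forall g h : pser, (forall k, f k = ps_mul g h k) -> ps_unit g \/ ps_unit h].
Definition ps_of_poly (f : {poly R}) : pser := fun k => f`_k.

(* pi-adic completion: inverse limit of R/(pi^n); an element is a compatible
   family (x n mod pi^n)_n, represented by representatives x n : R with
   x (n+1) = x n mod pi^n, two families being equal iff x n = y n mod pi^n
   for all n. *)
Definition cpl_elt (pi : R) (x : nat -> R) : Prop :=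
  forall n, dvdR (pi ^+ n) (x n.+1 - x n).
Definition cpl_eq (pi : R) (x y : nat -> R) : Prop :=
  forall n, dvdR (pi ^+ n) (x n - y n).
Definition cpl_of (r : R) : nat -> R := fun _ => r.
Definition cpl_unit (pi : R) (x : nat -> R) : Prop :=
  exists y, cpl_elt pi y /\ cpl_eq pi (fun n => x n * y n) (cpl_of 1).

Definition cpoly := seq (nat -> R).
Definition cpoly_elt (pi : R) (g : cpoly) : Prop :=
  forall i, (i < size g)%N -> cpl_elt pi (nth (cpl_of 0) g i).
Definition ccoef (g : cpoly) (i : nat) : nat -> R := nth (cpl_of 0) g i.
Definition cpoly_mulcoef (g h : cpoly) (k : nat) : nat -> R :=
  fun n => \sum_(i < k.+1) ccoef g i n * ccoef h (k - i)%N n.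
Definition cpoly_factor (pi : R) (f : {poly R}) (g h : cpoly) : Prop :=
  forall k, cpl_eq pi (cpl_of f`_k) (cpoly_mulcoef g h k).

End Defs.

(* Main.v *)
(* Let p be a prime and f_0 = u p^m.  A factorization f = g h over R[[X]] with p | g_0, h_0
   yields one over the polynomials of the completion: if p | f, take f = p (f / p); otherwise,
   by Weierstrass preparation, g is q^-1 times a distinguished polynomial q g, and q^-1 h is
   then a polynomial because f is.  Conversely, let f = G H over the completion, with
   G_0 = p^a v and v a unit.  Since R is dense in its completion, the coefficients of a unit
   series U can be chosen one by one so that g = G U lies in R[[X]] and g_0 = p^a; then f / g
   has coefficients both in R[1/p] and in the completion, hence in R.  If f_0 is a nonzero
   nonunit that is not associate to a prime power, it is a product of two coprime nonunits,
   and Bezout lifts this to a factorization of f in R[[X]], coefficient by coefficient.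

   Elements of the completion are handled level by level: a statement over the completion is
   a family of statements modulo p^n whose solutions are unique modulo p^n, hence
   compatible. *)
Require Import Defs.
From HB Require Import structures.
From mathcomp Require Import all_boot all_order all_algebra.
From mathcomp Require Import boolp ring zify.
Import GRing.Theory.
Local Open Scope ring_scope.

Set Implicit Arguments.
Unset Strict Implicit.
Unset Printing Implicit Defensive.

(** * Sequences built by course-of-values recursion *)

Definition upd (T : Type) (u : nat -> T) (k : nat) (x : T) : nat -> T :=
  fun i => if i == k then x else u i.

Lemma upd_same (T : Type) (u : nat -> T) k x : upd u k x k = x.
Proof. by rewrite /upd eqxx. Qed.

Lemma upd_lt (T : Type) (u : nat -> T) k x i : (i < k)%N -> upd u k x i = u i.
Proof. by rewrite /upd => /ltn_eqF ->. Qed.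

(** Dependent choice with access to all earlier values. By the first hypothesis [Q k] sees only the
    values up to [k], so later updates preserve it. *)
Lemma course_of_values_choice (T : Type) (t0 : T) (Q : nat -> (nat -> T) -> Prop) :
  (forall k u v, (forall i, (i <= k)%N -> u i = v i) -> Q k u -> Q k v) ->
  (forall k u, (forall i, (i < k)%N -> Q i u) -> exists x, Q k (upd u k x)) ->
  exists u, forall k, Q k u.
Proof.
move=> Qext Qtot.
have /choice[F FP] : forall ku : nat * (nat -> T), exists x,
    (forall i, (i < ku.1)%N -> Q i ku.2) -> Q ku.1 (upd ku.2 ku.1 x).
  case=> k u /=; case: (EM (forall i, (i < k)%N -> Q i u)) => [/Qtot[x Qx]|nQ].
    by exists x.
  by exists t0.
(* The first [k] values of [s k] are final; the others are the filler [t0]. *)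
pose s := fix s k := if k is k'.+1 then upd (s k') k' (F (k', s k')) else fun=> t0.
have sQ k : forall i, (i < k)%N -> Q i (s k).
  elim: k => // k IHk i; rewrite ltnS leq_eqVlt => /orP[/eqP->|lt_ik].
    exact: (FP (k, s k)).
  apply: (Qext _ (s k)); last exact: IHk.
  by move=> j le_ji; rewrite /= upd_lt // (leq_ltn_trans le_ji).
have s_stable k i n : (i < k)%N -> s (k + n)%N i = s k i.
  move=> lt_ik; elim: n => [|n IHn]; first by rewrite addn0.
  by rewrite addnS /= upd_lt // ltn_addr.
exists (fun k => s k.+1 k) => k; apply: (Qext _ (s k.+1)); last exact: sQ.
by move=> i le_ik; rewrite -(subnKC le_ik) -addSn s_stable.
Qed.

(** * Divisibility in an integral domain *)

Section Divisibility.
Variable R : idomainType.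
Implicit Types a b c d x y : R.

Lemma dvdRR a : dvdR a a.
Proof. by exists 1; rewrite mul1r. Qed.

Lemma dvdR0 a : dvdR a 0.
Proof. by exists 0; rewrite mul0r. Qed.

Lemma dvd1R a : dvdR 1 a.
Proof. by exists a; rewrite mulr1. Qed.

Lemma dvdR_trans b a c : dvdR a b -> dvdR b c -> dvdR a c.
Proof. by move=> [x ->] [y ->]; exists (y * x); rewrite mulrA. Qed.

Lemma dvdR_mull c a b : dvdR a b -> dvdR a (c * b).
Proof. by move=> [x ->]; exists (c * x); rewrite mulrA. Qed.

Lemma dvdR_mulr c a b : dvdR a b -> dvdR a (b * c).
Proof. by rewrite mulrC; apply: dvdR_mull. Qed.

Lemma dvdR_mul a b c d : dvdR a b -> dvdR c d -> dvdR (a * c) (b * d).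
Proof. by move=> [x ->] [y ->]; exists (x * y); rewrite mulrACA. Qed.

Lemma dvdR_add a b c : dvdR a b -> dvdR a c -> dvdR a (b + c).
Proof. by move=> [x ->] [y ->]; exists (x + y); rewrite mulrDl. Qed.

Lemma dvdR_opp a b : dvdR a b -> dvdR a (- b).
Proof. by move=> [x ->]; exists (- x); rewrite mulNr. Qed.

Lemma dvdR_sub a b c : dvdR a b -> dvdR a c -> dvdR a (b - c).
Proof. by move=> ab ac; apply/dvdR_add/dvdR_opp. Qed.

Lemma dvdR_subC a b c : dvdR a (b - c) -> dvdR a (c - b).
Proof. by move/dvdR_opp; rewrite opprB. Qed.

Lemma dvdR_sub_trans y a x z : dvdR a (x - y) -> dvdR a (y - z) -> dvdR a (x - z).
Proof. by move=> h1 h2; have := dvdR_add h1 h2; rewrite addrA subrK. Qed.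

Lemma dvdR_subr a b c : dvdR a (b - c) -> dvdR a c -> dvdR a b.
Proof. by move=> h /(dvdR_add h); rewrite subrK. Qed.

Lemma dvdR_sum (I : finType) (P : pred I) (F : I -> R) a :
  (forall i, P i -> dvdR a (F i)) -> dvdR a (\sum_(i | P i) F i).
Proof. by move=> aF; elim/big_ind: _ => //; [exact: dvdR0|exact: dvdR_add]. Qed.

Lemma dvdR_exp a m n : (m <= n)%N -> dvdR (a ^+ m) (a ^+ n).
Proof. by move=> le_mn; exists (a ^+ (n - m)); rewrite -exprD subnK. Qed.

Lemma dvdR_expW a m n b : (m <= n)%N -> dvdR (a ^+ n) b -> dvdR (a ^+ m) b.
Proof. by move=> /(dvdR_exp a); apply: dvdR_trans. Qed.

Lemma dvdR_pmul2l c a b : c != 0 -> dvdR (c * a) (c * b) -> dvdR a b.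
Proof. by move=> c0 [x]; rewrite mulrCA => /(mulfI c0) ->; exists x. Qed.

Lemma dvdR_unit a b : dvdR a b -> b \is a GRing.unit -> a \is a GRing.unit.
Proof. by move=> [c ->]; rewrite unitrM => /andP[]. Qed.

Lemma dvdR1_unit a : dvdR a 1 -> a \is a GRing.unit.
Proof. by move=> /dvdR_unit; apply; rewrite unitr1. Qed.

End Divisibility.

(** * The commutative ring of power series and its congruences *)

Section PowerSeriesRing.
Variable R : idomainType.
Implicit Types E F G H : pser R.

HB.instance Definition _ := gen_eqMixin (pser R).
HB.instance Definition _ := gen_choiceMixin (pser R).

Definition ps_add F G : pser R := fun k => F k + G k.
Definition ps_opp F : pser R := fun k => - F k.
Definition ps_zero : pser R := fun=> 0.

Lemma ps_addA : associative ps_add.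
Proof. by move=> F G H; apply: funext => k; apply: addrA. Qed.
Lemma ps_addC : commutative ps_add.
Proof. by move=> F G; apply: funext => k; apply: addrC. Qed.
Lemma ps_add0 : left_id ps_zero ps_add.
Proof. by move=> F; apply: funext => k; apply: add0r. Qed.
Lemma ps_addN : left_inverse ps_zero ps_opp ps_add.
Proof. by move=> F; apply: funext => k; apply: addNr. Qed.

HB.instance Definition _ :=
  GRing.isZmodule.Build (pser R) ps_addA ps_addC ps_add0 ps_addN.

Definition ps_trunc n F : {poly R} := \poly_(i < n) F i.

(** Transfers commutativity and associativity from polynomials to series. *)
Lemma ps_mul_trunc n F G k : (k < n)%N ->
  ps_mul F G k = (ps_trunc n F * ps_trunc n G)`_k.
Proof.
move=> lt_kn; rewrite coefM; apply: eq_bigr => i _.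
by rewrite !coef_poly !(leq_ltn_trans _ lt_kn) ?leq_subr // -ltnS.
Qed.

Lemma ps_mul_ext k F G F' G' : (forall i, (i <= k)%N -> F i = F' i) ->
  (forall i, (i <= k)%N -> G i = G' i) -> ps_mul F G k = ps_mul F' G' k.
Proof.
by move=> eF eG; apply: eq_bigr => i _; rewrite eF ?eG ?leq_subr // -ltnS.
Qed.

Lemma ps_mulC : commutative (@ps_mul R).
Proof.
by move=> F G; apply: funext => k; rewrite !(ps_mul_trunc _ _ (ltnSn k)) mulrC.
Qed.

Lemma ps_mulA : associative (@ps_mul R).
Proof.
move=> F G H; apply: funext => k; pose T := ps_trunc k.+1.
transitivity (T F * (T G * T H))`_k.
  rewrite coefM; apply: eq_bigr => i _.
  by rewrite coef_poly ltn_ord (@ps_mul_trunc k.+1) // ltnS leq_subr.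
rewrite mulrA coefM; apply: eq_bigr => i _.
by rewrite coef_poly ltnS leq_subr (@ps_mul_trunc k.+1).
Qed.

Lemma ps_mul1 : left_id (@ps_one R) (@ps_mul R).
Proof.
move=> F; apply: funext => k; rewrite /ps_mul big_ord_recl subn0 mul1r.
by rewrite big1 ?addr0 // => i _; rewrite mul0r.
Qed.

Lemma ps_mulDl : left_distributive (@ps_mul R) +%R.
Proof.
move=> F G H; apply: funext => k; rewrite -[RHS]big_split.
by apply: eq_bigr => i _; apply: mulrDl.
Qed.

Lemma ps_one_neq0 : @ps_one R != 0.
Proof.
by apply/eqP => /(congr1 (fun F : pser R => F 0%N)) /eqP; rewrite /ps_one oner_eq0.
Qed.

HB.instance Definition _ := GRing.Zmodule_isComNzRing.Build (pser R)
  ps_mulA ps_mulC ps_mul1 ps_mulDl ps_one_neq0.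

Lemma ps_coefB F G k : (F - G) k = F k - G k. Proof. by []. Qed.
Lemma ps_coefM F G k : (F * G) k = \sum_(i < k.+1) F i * G (k - i)%N.
Proof. by []. Qed.

Lemma ps_coefM0 F G : (F * G) 0%N = F 0%N * G 0%N.
Proof. by rewrite ps_coefM big_ord1. Qed.

Lemma ps_coefM_head F G k :
  (F * G) k = F 0%N * G k + \sum_(i < k) F i.+1 * G (k - i.+1)%N.
Proof. by rewrite ps_coefM big_ord_recl subn0. Qed.

Definition ps_const (c : R) : pser R := fun k => if k is 0 then c else 0.

Lemma ps_coef_constM c F k : (ps_const c * F) k = c * F k.
Proof. by rewrite ps_coefM_head big1 ?addr0 // => i _; rewrite mul0r. Qed.

Lemma ps_unitE F : ps_unit F <-> exists G, F * G = 1.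
Proof.
split=> -[G FG]; exists G; first by apply: funext => k; exact: FG.
by move=> k; rewrite -[ps_mul F G]/(F * G) FG.
Qed.

(* [D] is the relation up to which the equation [F G = E] is solved: equality for
   units, divisibility by a power of a prime for units of the completion. *)
Lemma ps_solve (D : R -> Prop) F E :
  (forall e, exists x, D (F 0%N * x - e)) ->
  exists G, forall k, D ((F * G) k - E k).
Proof.
move=> solve; apply: (course_of_values_choice 0) => [k u v euv|k u _].
  suff -> : (F * u) k = (F * v) k by [].
  exact: ps_mul_ext.
have [x Dx] := solve (E k - \sum_(i < k) F i.+1 * u (k - i.+1)%N).
exists x; rewrite ps_coefM_head upd_same.
under eq_bigr => i _ do
  rewrite upd_lt ?ltn_subrL ?(leq_ltn_trans _ (ltn_ord i)) //.
by move: Dx; congr D; ring.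
Qed.

Lemma ps_unitP F : ps_unit F <-> F 0%N \is a GRing.unit.
Proof.
rewrite ps_unitE; split=> [[G /(congr1 (fun H : pser R => H 0%N))]|F0].
  by rewrite ps_coefM0 => FG; apply/unitrPr; exists (G 0%N).
have [|G FG] := @ps_solve (fun x => x = 0) F 1.
  by move=> e; exists ((F 0%N)^-1 * e); rewrite mulVKr ?subrr.
by exists G; apply: funext => k; apply: subr0_eq.
Qed.

(** The quotient of [F] by [X^d] once the terms of degree below [d] are dropped. *)
Definition ps_shift d F : pser R := fun k => F (d + k)%N.

Definition eqmod (a : R) F G := forall k, dvdR a (F k - G k).

Lemma eqmod_sym a F G : eqmod a F G -> eqmod a G F.
Proof. by move=> FG k; apply/dvdR_subC. Qed.

Lemma eqmod_trans a G F H : eqmod a F G -> eqmod a G H -> eqmod a F H.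
Proof. by move=> FG GH k; apply: dvdR_sub_trans (FG k) (GH k). Qed.

Lemma dvdR_coefM a F G k : (forall i, (i <= k)%N -> dvdR a (G i)) -> dvdR a ((F * G) k).
Proof. by move=> aG; apply: dvdR_sum => i _; apply/dvdR_mull/aG/leq_subr. Qed.

Lemma eqmodMl a F G H : eqmod a G H -> eqmod a (F * G) (F * H).
Proof. by move=> GH k; rewrite -ps_coefB -mulrBr; apply: dvdR_coefM => i _; exact: GH. Qed.

Lemma eqmodMr a F G H : eqmod a G H -> eqmod a (G * F) (H * F).
Proof. by rewrite ![_ * F]mulrC; apply: eqmodMl. Qed.

Lemma eqmodW a b F G : dvdR a b -> eqmod b F G -> eqmod a F G.
Proof. by move=> ab FG k; apply: dvdR_trans ab (FG k). Qed.

End PowerSeriesRing.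

(** * Chain condition, Bezout and primes in a principal ideal domain *)

Section PrincipalIdealDomain.
Variable R : idomainType.
Hypothesis hR : PID R.
Implicit Types a b c d p x y : R.

(** A generator of the union of the ideals [(a n)] already lies in one of them, and there the chain
    stops. *)
Lemma PID_acc (a : nat -> R) :
  (forall n, dvdR (a n.+1) (a n)) -> exists n, dvdR (a n) (a n.+1).
Proof.
move=> aS; have aD m n : dvdR (a (n + m)%N) (a n).
  elim: m => [|m]; first by rewrite addn0; exact: dvdRR.
  by rewrite addnS; apply: dvdR_trans.
have [|b bP] := hR (I := fun x => exists n, dvdR (a n) x).
  split=> [|x y [m mx] [n ny]|r x [n nx]].
  - by exists 0%N; exact: dvdR0.
  - exists (m + n)%N; apply: dvdR_add; first exact: dvdR_trans mx.
    by apply: dvdR_trans ny; rewrite addnC.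
  - by exists n; exact: dvdR_mull.
have [n nb] : exists n, dvdR (a n) b by apply/bP; exact: dvdRR.
exists n; apply: dvdR_trans nb _; apply/bP.
by exists n.+1; exact: dvdRR.
Qed.

Lemma PID_bezout a b : exists d, [/\ dvdR d a, dvdR d b & exists x y, d = x * a + y * b].
Proof.
have [|d dP] := hR (I := fun z => exists x y, z = x * a + y * b).
  split=> [|_ _ [x [y ->]] [x' [y' ->]]|r _ [x [y ->]]].
  - by exists 0, 0; ring.
  - by exists (x + x'), (y + y'); ring.
  - by exists (r * x), (r * y); ring.
exists d; split; try apply/dP.
- by exists 1, 0; ring.
- by exists 0, 1; ring.
- exact: dvdRR.
Qed.

(** The gcd [d] of [p] and [x] is either associate to [p], so that [p] divides [x], or a unit, and
    then Bezout writes [y] as a combination of [p] and [x * y]. *)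
Lemma PID_irreducible_prime p : p != 0 -> p \isn't a GRing.unit ->
  (forall x y, p = x * y -> x \is a GRing.unit \/ y \is a GRing.unit) ->
  prime_elt p.
Proof.
move=> p0 pU irr; split=> // x y pxy.
have [d [[e pE] dx [u [v dE]]]] := PID_bezout p x.
case: (irr _ _ pE) => [eU|dU]; [left|right].
  by apply: dvdR_trans dx; exists e^-1; rewrite pE mulKr.
have -> : y = d^-1 * (u * y * p + v * (x * y)).
  by rewrite -[LHS](mulKr dU) dE; congr (_ * _); ring.
by apply/dvdR_mull/dvdR_add; apply: dvdR_mull => //; exact: dvdRR.
Qed.

(** Without a prime divisor, every nonunit divisor of [a] would split properly, giving an endless
    chain of proper divisors. *)
Lemma PID_prime_divisor a : a != 0 -> a \isn't a GRing.unit ->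
  exists p, prime_elt p /\ dvdR p a.
Proof.
move=> a0 aU; apply: contrapT => noprime.
pose bad x := [/\ x != 0, x \isn't a GRing.unit & dvdR x a].
have step (s : {x | bad x}) : {t : {x | bad x} |
    dvdR (sval t) (sval s) /\ ~ dvdR (sval s) (sval t)}.
  case: s => x [x0 xU xa] /=; apply: cid.
  have [y [z [xE yU zU]]] : exists y z, [/\ x = y * z, y \isn't a GRing.unit &
      z \isn't a GRing.unit].
    apply: contrapT => irr; apply: noprime; exists x; split=> //.
    apply: PID_irreducible_prime => // y z xE.
    case: (boolP (y \is a GRing.unit)) => [|yU]; first by left.
    by right; apply: contrapT => /negP zU; apply: irr; exists y, z.
  have [y0 z0] : y != 0 /\ z != 0.
    by move: x0; rewrite xE mulf_eq0 negb_or => /andP.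
  have yx : dvdR y x by rewrite xE mulrC; exists z.
  have ybad : bad y by split=> //; apply: dvdR_trans xa.
  exists (exist _ y ybad); split=> //= xy.
  move/negP: zU; apply; apply: dvdR1_unit; apply: (dvdR_pmul2l y0).
  by rewrite mulr1 -xE.
have abad : bad a by split=> //; exact: dvdRR.
have [s [_ sP]] := dependent_choice step (exist _ a abad).
have [|n] := @PID_acc (fun n => sval (s n)); first by move=> n; case: (sP n).
by case: (sP n).
Qed.

(** * Valuation at a prime, inverses modulo its powers, units of the completion *)

Section Prime.
Variable p : R.
Hypothesis pP : prime_elt p.

Lemma prime_elt_neq0 : p != 0. Proof. by case: pP. Qed.

Lemma prime_elt_exp_neq0 n : p ^+ n != 0.
Proof. exact/expf_neq0/prime_elt_neq0. Qed.

Lemma prime_elt_dvdM x y : dvdR p (x * y) -> dvdR p x \/ dvdR p y.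
Proof. by case: pP => _ _; apply. Qed.

Lemma prime_elt_ndvd1 : ~ dvdR p 1.
Proof. by move=> /dvdR1_unit; case: pP => _ /negP. Qed.

Lemma prime_elt_dvd_nunit x : dvdR p x -> x \isn't a GRing.unit.
Proof. by move=> px; apply/negP => /(dvdR_unit px); case: pP => _ /negP. Qed.

Lemma prime_elt_dvdX n x : (0 < n)%N -> dvdR (p ^+ n) x -> dvdR p x.
Proof. by move=> n0; rewrite -{2}(expr1 p); apply: dvdR_expW. Qed.

(** If every power of [p] divided [a], the quotients [c n = p * c n.+1] would contradict the chain
    condition. *)
Lemma prime_elt_valuation a : a != 0 -> exists m c, a = c * p ^+ m /\ ~ dvdR p c.
Proof.
move=> a0; suff [m nm] : exists m, ~ dvdR (p ^+ m) a.
  elim: m nm => [|m IHm] nm; first by case: nm; exact: dvd1R.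
  case: (EM (dvdR (p ^+ m) a)) => [[c aE]|]; last exact: IHm.
  exists m, c; split=> // -[e cE]; apply: nm; exists e.
  by rewrite aE cE exprS mulrA.
apply: contrapT => all.
have /choice[c cP] : forall n, exists c, a = c * p ^+ n.
  by move=> n; apply: contrapT => nn; apply: all; exists n.
have cS n : c n = p * c n.+1.
  by apply: (mulIf (prime_elt_exp_neq0 n)); rewrite -cP (cP n.+1) exprS; ring.
have [|n] := @PID_acc c; first by move=> n; exists p.
have cn0 : c n.+1 != 0 by apply: contra_neq a0 => c0; rewrite (cP n.+1) c0 mul0r.
rewrite cS mulrC -{2}[c n.+1]mulr1 => /(dvdR_pmul2l cn0).
exact: prime_elt_ndvd1.
Qed.

Lemma prime_elt_inv_mod c n : ~ dvdR p c -> exists y, dvdR (p ^+ n) (c * y - 1).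
Proof.
move=> npc; have [d [[e pE] dc [x [y dE]]]] := PID_bezout p c.
have dU : d \is a GRing.unit.
  case: (@prime_elt_dvdM e d); first by rewrite -pE; exact: dvdRR.
    move=> [e' eE]; apply: dvdR1_unit; exists e'.
    by apply: (mulfI prime_elt_neq0); rewrite mulr1 {1}pE eE; ring.
  by move=> /dvdR_trans/(_ dc).
have [y0 [t y0P]] : exists y0, dvdR p (c * y0 - 1).
  exists (d^-1 * y), (- (d^-1 * x)); rewrite -{1}(mulVr dU) dE; ring.
elim: n => [|n [z [s zP]]]; first by exists 0; exact: dvd1R.
(* The new error is, up to sign, the product of the errors of [y0] and [z], which gains one power of
   [p]. *)
exists (z + y0 - c * z * y0), (- (t * s)).
rewrite exprS; transitivity (- ((c * y0 - 1) * (c * z - 1))); first by ring.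
by rewrite zP y0P; ring.
Qed.

Lemma prime_elt_ndvd_cancel n c x : ~ dvdR p c -> dvdR (p ^+ n) (c * x) -> dvdR (p ^+ n) x.
Proof.
move=> /(prime_elt_inv_mod n)[y yP] cx.
have -> : x = y * (c * x) - (c * y - 1) * x by ring.
by apply: dvdR_sub; [exact: dvdR_mull | exact: dvdR_mulr].
Qed.

(** [x] divides [p ^+ m] because [u] is a unit, and is invertible modulo [p ^+ m]; hence it divides
    1. *)
Lemma prime_elt_pow_factor u m x y : u \is a GRing.unit -> x * y = u * p ^+ m ->
  ~ dvdR p x -> x \is a GRing.unit.
Proof.
move=> uU xy /(prime_elt_inv_mod m)[z zP]; apply: dvdR1_unit.
have -> : 1 = x * z - (x * z - 1) by ring.
apply: dvdR_sub; first exact/dvdR_mulr/dvdRR.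
apply: dvdR_trans zP; exists (u^-1 * y).
by rewrite -[LHS](mulKr uU) -xy; ring.
Qed.

Lemma ps_inv_mod (F : pser R) n : ~ dvdR p (F 0%N) -> exists G, eqmod (p ^+ n) (F * G) 1.
Proof.
move=> /(prime_elt_inv_mod n)[y yP]; apply: ps_solve => e; exists (y * e).
have -> : F 0%N * (y * e) - e = (F 0%N * y - 1) * e by ring.
exact: dvdR_mulr.
Qed.

Lemma cpl_elt_le (x : nat -> R) n k : cpl_elt p x -> (n <= k)%N -> dvdR (p ^+ n) (x k - x n).
Proof.
move=> xP /subnKC <-; elim: (k - n)%N => [|j IHj].
  by rewrite addn0 subrr; exact: dvdR0.
rewrite addnS; apply: dvdR_sub_trans IHj.
by apply: dvdR_expW (xP _); exact: leq_addr.
Qed.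

Lemma cpl_elt_dvd (x : nat -> R) j n k : cpl_elt p x -> (j <= n)%N -> (j <= k)%N ->
  dvdR (p ^+ j) (x n) -> dvdR (p ^+ j) (x k).
Proof.
move=> xP jn jk xn; apply: (@dvdR_subr _ _ _ (x j)); first exact: cpl_elt_le.
apply: dvdR_subr xn; apply/dvdR_subC; exact: cpl_elt_le.
Qed.

(** Only levels [n > 0] determine the residue modulo [p]: the representative [x 0] is arbitrary. *)
Lemma cpl_nunit (x : nat -> R) n : cpl_elt p x -> (0 < n)%N ->
  dvdR p (x n) -> ~ cpl_unit p x.
Proof.
rewrite -{2}(expr1 p) => xP n0 pxn [y [yP xy]]; apply: prime_elt_ndvd1.
have := xy 1%N; rewrite expr1 => /dvdR_subC/dvdR_subr; apply.
apply: dvdR_mulr; rewrite -[p in dvdR p _]expr1.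
exact: (@cpl_elt_dvd x 1 n).
Qed.

Lemma cpl_unitP (x : nat -> R) n : cpl_elt p x -> (0 < n)%N ->
  ~ dvdR p (x n) -> cpl_unit p x.
Proof.
move=> xP n0 npx.
have npxS k : ~ dvdR p (x k.+1).
  move=> pxk; apply: npx; rewrite -[p]expr1.
  by apply: (@cpl_elt_dvd x 1 k.+1) => //; rewrite expr1.
(* The inverse at level [k] is taken from [x k.+1], since [p] may divide [x 0]. Uniqueness of
   inverses modulo [p ^+ k] gives compatibility. *)
have /choice[y yP] : forall k, exists z, dvdR (p ^+ k) (x k.+1 * z - 1).
  by move=> k; exact: prime_elt_inv_mod.
exists y; split=> k.
  apply: (prime_elt_ndvd_cancel (npxS k)).
  have -> : x k.+1 * (y k.+1 - y k) = (x k.+2 * y k.+1 - 1) - (x k.+1 * y k - 1)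
    - (x k.+2 - x k.+1) * y k.+1 by ring.
  apply: dvdR_sub; last by apply: dvdR_mulr; apply: dvdR_expW (xP _).
  by apply: dvdR_sub => //; apply: dvdR_expW (yP _).
have -> : x k * y k - cpl_of 1 k = x k.+1 * y k - 1 - (x k.+1 - x k) * y k.
  by rewrite /cpl_of; ring.
by apply: dvdR_sub => //; apply: dvdR_mulr.
Qed.

End Prime.
End PrincipalIdealDomain.

(** * Lifting a coprime factorization of the constant term *)

Lemma ps_coprime_factor (R : idomainType) (f : pser R) (a b x y : R) :
  f 0%N = a * b -> x * a + y * b = 1 ->
  exists g h : pser R, [/\ f = g * h, g 0%N = a & h 0%N = b].
Proof.
move=> f0 xy.
pose Q k (u : nat -> R * R) :=
  f k = (((fun i => (u i).1) : pser R) * ((fun i => (u i).2) : pser R)) k /\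
  (k = 0%N -> u 0%N = (a, b)).
have [| |u uP] := @course_of_values_choice _ (0, 0) Q.
- move=> k u v euv [fE u0]; split; last by rewrite -euv.
  by rewrite fE; apply: ps_mul_ext => i le_ik /=; rewrite euv.
- move=> [|k] u IH.
    by exists (a, b); split=> //; rewrite ps_coefM0 upd_same.
  have u0 : u 0%N = (a, b) by case: (IH 0%N) => // _; apply.
  (* The two new coefficients enter only as [b] times the first plus [a] times the second, which
     must equal [e]; multiply the Bezout relation by [e]. *)
  pose e := f k.+1 - \sum_(i < k) (u i.+1).1 * (u (k - i)%N).2.
  exists (y * e, x * e); split=> //.
  rewrite ps_coefM big_ord_recl big_ord_recr /= subn0 subnn !upd_same upd_lt //= u0 /=.
  under eq_bigr => i _.
    rewrite /bump /= add1n subSS !upd_lt ?ltnS //; last exact: leq_subr.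
    over.
  have -> : f k.+1 = e + \sum_(i < k) (u i.+1).1 * (u (k - i)%N).2 by rewrite subrK.
  by rewrite -{1}[e]mulr1 -xy; ring.
exists (fun i => (u i).1), (fun i => (u i).2).
have u0 : u 0%N = (a, b) by case: (uP 0%N) => _; apply.
by rewrite u0; split=> //; apply: funext => k; case: (uP k).
Qed.

(** * Weierstrass preparation modulo powers of a prime *)

Section Weierstrass.
Variable R : idomainType.
Hypothesis hR : PID R.
Variable p : R.
Hypothesis pP : prime_elt p.
Implicit Types (f g h q z F G : pser R).

Lemma ps_coefM_shift F G d k :
  (F * G) (d + k)%N =
  (F * ps_shift d G) k + \sum_(i < d) F (k.+1 + i)%N * G (d - i.+1)%N.
Proof.
have e : (d + k).+1 = (k.+1 + d)%N by lia.
rewrite ps_coefM e big_split_ord; congr (_ + _); apply: eq_bigr => i _ /=.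
  by rewrite /ps_shift addnBA // -ltnS.
by congr (_ * G _); lia.
Qed.

(** Modulo [a] the series [G] is [X^d] times its shift. *)
Lemma ps_coefM_shift_mod a F G d k : (forall i, (i < d)%N -> dvdR a (G i)) ->
  dvdR a ((F * G) (d + k)%N - (F * ps_shift d G) k).
Proof.
move=> aG; rewrite ps_coefM_shift addrC addKr; apply: dvdR_sum => i _.
by apply/dvdR_mull/aG; rewrite ltn_subrL (leq_ltn_trans _ (ltn_ord i)).
Qed.

(** Uniqueness in Weierstrass division. By induction [z = p ^+ n * y]; the shift of [g] is a unit
    modulo [p], so the hypothesis one power up forces [y] to vanish modulo [p]. *)
Lemma weierstrass_inj d g n z : (forall i, (i < d)%N -> dvdR p (g i)) -> ~ dvdR p (g d) ->
  (forall k, dvdR (p ^+ n) ((z * g) (d + k)%N)) -> forall k, dvdR (p ^+ n) (z k).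
Proof.
move=> glow gd; elim: n => [|n IHn] zg; first by move=> k; exact: dvd1R.
have [y yP] : exists y : pser R, forall k, z k = y k * p ^+ n.
  have /choice[y yP] : forall k, exists c, z k = c * p ^+ n.
    by apply: IHn => k; apply: dvdR_expW (zg k).
  by exists y.
have zE : z = ps_const (p ^+ n) * y.
  by apply: funext => k; rewrite ps_coef_constM yP mulrC.
have [|B' BB'] := @ps_inv_mod _ hR _ pP (ps_shift d g) 1; first by rewrite /ps_shift addn0.
have yB : eqmod (p ^+ 1) (y * ps_shift d g) 0.
  move=> k; rewrite subr0 expr1.
  have := ps_coefM_shift_mod y k glow => /dvdR_subC/dvdR_subr; apply.
  apply: (dvdR_pmul2l (prime_elt_exp_neq0 pP n)).
  by rewrite -exprSr -ps_coef_constM mulrA -zE.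
have y0 : eqmod (p ^+ 1) y 0.
  rewrite -[y]mulr1; apply: eqmod_trans (eqmodMl _ (eqmod_sym BB')) _.
  by rewrite mulrA -(mul0r B'); apply: eqmodMr.
move=> k; rewrite zE ps_coef_constM exprSr; apply: dvdR_mul; first exact: dvdRR.
by have := y0 k; rewrite subr0 expr1.
Qed.

(** Makes [q * g] monic of degree [d] modulo [p ^+ n]. The error [p ^+ n * E] is removed by means of
    an inverse [B'] modulo [p] of the shift of [g]. *)
Lemma weierstrass_exists d g n : (forall i, (i < d)%N -> dvdR p (g i)) -> ~ dvdR p (g d) ->
  exists q, forall k, dvdR (p ^+ n) ((q * g) (d + k)%N - (k == 0%N)%:R).
Proof.
move=> glow gd; elim: n => [|n [q /choice[E EP]]].
  by exists 0 => k; exact: dvd1R.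
have [|B' BB'] := @ps_inv_mod _ hR _ pP (ps_shift d g) 1; first by rewrite /ps_shift addn0.
exists (q - ps_const (p ^+ n) * ((E : pser R) * B')) => k.
rewrite mulrBl -mulrA ps_coefB ps_coef_constM addrAC EP mulrC -mulrBr exprSr.
apply: dvdR_mul; first exact: dvdRR.
apply: dvdR_subC; apply: dvdR_sub_trans (ps_coefM_shift_mod _ k glow) _.
have := eqmodMl (E : pser R) BB'; rewrite mulr1 [_ g * B']mulrC mulrA => /(_ k).
by rewrite expr1.
Qed.

(** Modulo [p ^+ n.+1] the series [g] is a monic polynomial of degree [d], so from degree [N + d] on
    [g * h] involves only the coefficients of [h] from [N] on. These products vanish, and uniqueness
    applies to the shift of [h]. *)
Lemma weierstrass_quotient_poly d g n f h N : (forall i, (i < d)%N -> dvdR p (g i)) ->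
  (forall k, dvdR (p ^+ n.+1) (g (d + k)%N - (k == 0%N)%:R)) ->
  eqmod (p ^+ n.+1) f (g * h) -> (forall k, (N <= k)%N -> f k = 0) ->
  forall k, (N <= k)%N -> dvdR (p ^+ n.+1) (h k).
Proof.
move=> glow ghigh fgh f0 k /subnKC <-; move: (k - N)%N => {}k.
rewrite -[h _]/(ps_shift N h k); move: k; apply: (@weierstrass_inj d g) => //.
  move=> gd; apply: (prime_elt_ndvd1 pP).
  have := ghigh 0%N; rewrite addn0 => /(prime_elt_dvdX (ltn0Sn n)).
  by move=> /dvdR_subC/dvdR_subr; apply.
move=> k; have := fgh (N + (d + k))%N.
rewrite f0 ?leq_addr // sub0r ps_coefM_shift => /dvdR_opp; rewrite opprK [_ * g]mulrC.
rewrite -[\sum_(i < N) _]opprK => /dvdR_subr; apply; apply/dvdR_opp/dvdR_sum => i _.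
apply: dvdR_mulr; have := ghigh (k + i).+1; rewrite subr0.
by rewrite addnS -addSn addnA addSn.
Qed.

Lemma ps_factor_cpoly (f : {poly R}) (g h : pser R) :
  ps_of_poly f = g * h -> dvdR p (g 0%N) -> dvdR p (h 0%N) ->
  exists G H : cpoly R, [/\ cpoly_elt p G, cpoly_elt p H, cpoly_factor p f G H,
    ~ cpl_unit p (ccoef G 0) & ~ cpl_unit p (ccoef H 0)].
Proof.
move=> fgh pg0 ph0.
case: (EM (forall k, dvdR p f`_k)) => [/choice[e eP]|npf].
  (* The length [(size f).+1] provides a constant coefficient even for [f = 0]. *)
  exists [:: cpl_of p], (mkseq (fun i => cpl_of (e i)) (size f).+1).
  have cst (r : R) : cpl_elt p (cpl_of r) by move=> n; rewrite subrr; exact: dvdR0.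
  split.
  - by case=> // _; exact: cst.
  - by move=> i; rewrite size_mkseq => lti; rewrite nth_mkseq //; exact: cst.
  - move=> k n; rewrite /cpoly_mulcoef big_ord_recl big1 ?addr0; last first.
      by move=> i _; rewrite /ccoef nth_default // mul0r.
    rewrite /ccoef subn0 /=; case: (ltnP k (size f).+1) => [ltk|gek].
      by rewrite nth_mkseq // /cpl_of eP mulrC subrr; exact: dvdR0.
    have fk0 : f`_k = 0 by rewrite nth_default // ltnW.
    rewrite fk0 [nth _ (mkseq _ _) _]nth_default ?size_mkseq // /cpl_of mulr0 subrr.
    exact: dvdR0.
  - by apply: (@cpl_nunit _ _ pP _ 1 (cst _)) => //; exact: dvdRR.
  - rewrite /ccoef nth_mkseq //; apply: (@cpl_nunit _ _ pP _ 1 (cst _)) => //.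
    (* [p * p] divides [f_0], so [p] still divides the constant term of [f / p]. *)
    apply: (dvdR_pmul2l (prime_elt_neq0 pP)); rewrite [p * cpl_of _ _]mulrC -eP.
    by rewrite -[f`_0]/(ps_of_poly f 0%N) fgh ps_coefM0; exact: dvdR_mul.
have exd : exists d, `[< ~ dvdR p (g d) >].
  apply: contrapT => alld; apply: npf => k; rewrite -[f`_k]/(ps_of_poly f k) fgh mulrC.
  apply: dvdR_coefM => i _; apply: contrapT => npg; apply: alld; exists i; exact/asboolP.
case: (ex_minnP exd) => d /asboolP gd dmin.
have glow i : (i < d)%N -> dvdR p (g i).
  by move=> ltid; apply: contrapT => /asboolP/dmin; rewrite leqNgt ltid.
(* Level [n] is solved modulo [p ^+ n.+1], so that [q n] has constant term prime to [p] even for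
   [n = 0]. *)
have /choice[q qP] := fun n => weierstrass_exists n.+1 glow gd.
have q0 n : ~ dvdR p (q n 0%N).
  move=> pq0; apply: (prime_elt_ndvd1 pP).
  have := qP n 0%N => /(prime_elt_dvdX (ltn0Sn n))/dvdR_subC/dvdR_subr; apply.
  apply: (dvdR_subr (ps_coefM_shift_mod (q n) 0 glow)).
  by rewrite ps_coefM0; exact: dvdR_mulr.
have /choice[q' q'P] := fun n => @ps_inv_mod _ hR _ pP (q n) n.+1 (q0 n).
(* Uniqueness gives compatibility: both products with [g] agree from degree [d] on. *)
have qS n : eqmod (p ^+ n) (q n.+1) (q n).
  move=> k; rewrite -ps_coefB; apply: (@dvdR_expW _ _ _ n.+1) => //; move: k.
  apply: (weierstrass_inj glow gd) => k; rewrite mulrBl ps_coefB.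
  apply: dvdR_sub_trans (dvdR_subC (qP n k)).
  exact: dvdR_expW (qP n.+1 k).
(* Inverses are unique: both sides agree with [q' n.+1 * q n * q' n]. *)
have q'S n : eqmod (p ^+ n) (q' n.+1) (q' n).
  have le1 : dvdR (p ^+ n) (p ^+ n.+1) by exact: dvdR_exp.
  have le2 : dvdR (p ^+ n) (p ^+ n.+2) by apply: dvdR_exp; lia.
  have h1 := eqmodMl (q' n.+1) (eqmod_sym (eqmodW le1 (q'P n))).
  have h2 := eqmodMr (q' n.+1 * q' n) (eqmod_sym (qS n)).
  have h3 := eqmodMr (q' n) (eqmodW le2 (q'P n.+1)).
  rewrite mulr1 mulrCA in h1; rewrite mul1r -mulrA in h3.
  exact: eqmod_trans h1 (eqmod_trans h2 h3).
pose N := (size f).+1.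
have q'h n : forall k, (N <= k)%N -> dvdR (p ^+ n.+1) ((q' n * h) k).
  apply: (@weierstrass_quotient_poly d (q n * g) n (ps_of_poly f)).
  - by move=> i ltid; apply: dvdR_coefM => j leji; apply: glow; exact: leq_ltn_trans ltid.
  - exact: qP.
  - rewrite fgh mulrACA -{1}[g * h]mul1r; apply/eqmodMr/eqmod_sym; exact: q'P.
  - by move=> k /ltnW lek; rewrite /ps_of_poly nth_default.
(* The coefficients cut off here vanish modulo [p ^+ n.+1]. *)
pose G := mkseq (fun i n => (q n * g) i) d.+1.
pose H := mkseq (fun i n => (q' n * h) i) N.
have GE n : eqmod (p ^+ n) (fun i => ccoef G i n) (q n * g).
  move=> i; rewrite /ccoef; case: (ltnP i d.+1) => [lti|gei].
    by rewrite nth_mkseq // subrr; exact: dvdR0.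
  rewrite nth_default ?size_mkseq //; apply/dvdR_subC; apply: (@dvdR_expW _ _ _ n.+1) => //.
  by have := qP n (i - d)%N; rewrite subnKC 1?ltnW // subn_eq0 leqNgt gei.
have HE n : eqmod (p ^+ n) (fun i => ccoef H i n) (q' n * h).
  move=> i; rewrite /ccoef; case: (ltnP i N) => [lti|gei].
    by rewrite nth_mkseq // subrr; exact: dvdR0.
  rewrite nth_default ?size_mkseq //; apply/dvdR_subC; rewrite /cpl_of subr0.
  by apply: (@dvdR_expW _ _ _ n.+1) => //; exact: q'h.
have Gelt : cpoly_elt p G.
  move=> i; rewrite size_mkseq => lti; rewrite nth_mkseq // => n.
  exact: eqmodMr (qS n) i.
have Helt : cpoly_elt p H.
  move=> i; rewrite size_mkseq => lti; rewrite nth_mkseq // => n.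
  exact: eqmodMr (q'S n) i.
exists G, H; split=> //.
- move=> k n; rewrite -[cpl_of _ _]/(ps_of_poly f k) fgh.
  suff : eqmod (p ^+ n) (g * h) 
    (((fun i => ccoef G i n) : pser R) * ((fun i => ccoef H i n) : pser R)) by apply.
  apply: eqmod_sym; apply: eqmod_trans (eqmodMr _ (GE n)) _.
  apply: eqmod_trans (eqmodMl _ (HE n)) _; rewrite mulrACA -[X in eqmod _ _ X]mul1r.
  by apply: eqmodMr; apply: eqmodW (q'P n); exact: dvdR_exp.
- apply: (@cpl_nunit _ _ pP _ 1) => //; first exact: Gelt.
  by rewrite /ccoef nth_mkseq // ps_coefM0; exact: dvdR_mull.
- apply: (@cpl_nunit _ _ pP _ 1) => //; first exact: Helt.
  by rewrite /ccoef nth_mkseq // ps_coefM0; exact: dvdR_mull.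
Qed.

End Weierstrass.

(** * Descent of a factorization from the completion to [R[[X]]] *)

Section Descent.
Variable R : idomainType.
Hypothesis hR : PID R.
Variable p : R.
Hypothesis pP : prime_elt p.
Implicit Types (f g h F G : pser R).

Lemma prime_elt_exp_ndvd u m : u \is a GRing.unit -> ~ dvdR (p ^+ m.+1) (u * p ^+ m).
Proof.
rewrite exprSr [u * _]mulrC => uU /(dvdR_pmul2l (prime_elt_exp_neq0 pP m)) pu.
by have /negP := prime_elt_dvd_nunit pP pu.
Qed.

Lemma cpl_eltM (x y : nat -> R) :
  cpl_elt p x -> cpl_elt p y -> cpl_elt p (fun n => x n * y n).
Proof.
move=> xP yP n.
have -> : x n.+1 * y n.+1 - x n * y n =
  x n.+1 * (y n.+1 - y n) + (x n.+1 - x n) * y n by ring.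
by apply: dvdR_add; [exact/dvdR_mull/yP | exact/dvdR_mulr/xP].
Qed.

Lemma cpl_elt_sum (I : finType) (F : I -> nat -> R) :
  (forall i, cpl_elt p (F i)) -> cpl_elt p (fun n => \sum_i F i n).
Proof. by move=> FP n; rewrite -sumrB; apply: dvdR_sum => i _; exact: FP. Qed.

Lemma cpl_div a (x d : nat -> R) : cpl_elt p x -> cpl_elt p d ->
  dvdR (p ^+ a) (x a) -> ~ dvdR (p ^+ a.+1) (x a.+1) -> dvdR (p ^+ a) (d a) ->
  exists w, cpl_elt p w /\ cpl_eq p (fun n => x n * w n) d.
Proof.
(* Cancelling [p ^+ a] costs [a] levels, so [w n] is computed at level [M n]; one level more shows
   that [x] has valuation exactly [a]. *)
move=> xP dP xa nxa da; pose M n := (n + a.+1)%N.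
have /choice[v vP] : forall n, exists v, x (M n) = p ^+ a * v /\ ~ dvdR p v.
  move=> n; have [|v vE] := cpl_elt_dvd (j := a) (n := a) (k := M n) xP (leqnn _) _ xa.
    by rewrite /M; lia.
  exists v; split; first by rewrite vE mulrC.
  move=> pv; apply: nxa; apply: (cpl_elt_dvd (n := M n) xP) => //; first exact: leq_addl.
  by rewrite vE exprS; apply: dvdR_mul => //; exact: dvdRR.
have /choice[w wP] : forall n, exists w, dvdR (p ^+ M n) (x (M n) * w - d (M n)).
  move=> n; have [|e eE] := cpl_elt_dvd (j := a) (n := a) (k := M n) dP (leqnn _) _ da.
    by rewrite /M; lia.
  have [vE npv] := vP n; have [y yP] := prime_elt_inv_mod hR pP n.+1 npv.
  exists (y * e); rewrite vE eE.
  have -> : p ^+ a * v n * (y * e) - e * p ^+ a = e * (p ^+ a * (v n * y - 1)) by ring.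
  rewrite /M addnC addSnnS exprD; apply/dvdR_mull/dvdR_mul => //; exact: dvdRR.
have MS n : M n.+1 = (M n).+1 by [].
exists w; split=> n.
  have [vE npv] := vP n; apply: (@dvdR_expW _ _ _ n.+1) => //.
  apply: (prime_elt_ndvd_cancel hR pP npv); apply: (dvdR_pmul2l (prime_elt_exp_neq0 pP a)).
  rewrite -exprD addnS -addSn addnC -/(M n) mulrA -vE.
  have -> : x (M n) * (w n.+1 - w n) = (x (M n.+1) * w n.+1 - d (M n.+1))
     - (x (M n) * w n - d (M n)) - (x (M n.+1) - x (M n)) * w n.+1
     + (d (M n.+1) - d (M n)) by ring.
  apply: dvdR_add; last exact: dP.
  apply: dvdR_sub; last by apply: dvdR_mulr; exact: xP.
  apply: dvdR_sub => //; apply: dvdR_expW (wP n.+1); rewrite MS; exact: leqnSn.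
have le_nM : (n <= M n)%N by exact: leq_addr.
have -> : x n * w n - d n = (x (M n) * w n - d (M n)) - (x (M n) - x n) * w n
  + (d (M n) - d n) by ring.
apply: dvdR_add; last exact: cpl_elt_le.
apply: dvdR_sub; first exact: dvdR_expW (wP n).
by apply: dvdR_mulr; exact: cpl_elt_le.
Qed.

(* Comparing [h] with a quotient modulo [p ^+ N] loses a factor [p ^+ a] of precision at
   each coefficient, so [N = a * k.+1] suffices for the [k]-th one. *)
Lemma ps_division a f g : g 0%N = p ^+ a ->
  (forall N, exists h, eqmod (p ^+ N) f (g * h)) -> exists h, f = g * h.
Proof.
move=> g0 fg.
have [| |h hP] := @course_of_values_choice R 0 (fun k (u : pser R) => f k = (g * u) k).
- by move=> k u v euv ->; exact: ps_mul_ext.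
- move=> k u IH; have [H HP] := fg (a * k.+1)%N.
  pose D := H - (u : pser R).
  have gD j : (j < k)%N -> dvdR (p ^+ (a * k.+1)) ((g * D) j).
    by move=> ltjk; rewrite mulrBr ps_coefB -IH //; exact/dvdR_subC.
  have DP j : (j < k)%N -> dvdR (p ^+ (a * (k - j))) (D j).
    elim/ltn_ind: j => j IHj ltjk.
    apply: (dvdR_pmul2l (prime_elt_exp_neq0 pP a)); rewrite -exprD -mulnS -subSn 1?ltnW //.
    have := gD j ltjk => /(dvdR_expW (m := (a * (k.+1 - j))%N)).
    rewrite leq_mul2l leq_subr orbT => /(_ isT).
    rewrite ps_coefM_head g0 -[\sum_(i < j) _]opprK => /dvdR_subr; apply.
    apply/dvdR_opp/dvdR_sum => i _; apply: dvdR_mull.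
    have lt_ij := ltn_ord i.
    apply: dvdR_expW (IHj (j - i.+1)%N _ _); [rewrite leq_mul2l; apply/orP; right| |]; lia.
  (* Solvability at [k]: [H] satisfies the same recursion modulo a multiple of [p ^+ a], and
     [p ^+ a] divides [D] below [k]. *)
  have [e eE] : dvdR (p ^+ a) (f k - \sum_(i < k) g i.+1 * u (k - i.+1)%N).
    have -> : f k - \sum_(i < k) g i.+1 * u (k - i.+1)%N =
        (f k - (g * H) k) + p ^+ a * H k + \sum_(i < k) g i.+1 * D (k - i.+1)%N.
      under [X in _ = _ + X]eq_bigr => i _ do rewrite /D ps_coefB mulrBr.
      by rewrite sumrB ps_coefM_head g0; ring.
    apply: dvdR_add; [apply: dvdR_add|apply: dvdR_sum => i _].
    + by apply: dvdR_expW (HP k); rewrite leq_pmulr.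
    + exact/dvdR_mulr/dvdRR.
    + apply: dvdR_mull; have lt_ik := ltn_ord i.
      by apply: dvdR_expW (DP _ _); [rewrite leq_pmulr //|]; lia.
  exists e; rewrite ps_coefM_head g0 upd_same mulrC -eE.
  under [X in _ = _ + X]eq_bigr => i _ do
    rewrite upd_lt ?ltn_subrL ?(leq_ltn_trans _ (ltn_ord i)) //.
  by rewrite subrK.
by exists h; apply: funext.
Qed.

Lemma ps_factor_descent f u m (G H : nat -> pser R) :
  u \is a GRing.unit -> f 0%N = u * p ^+ m ->
  (forall i, cpl_elt p (fun n => G n i)) ->
  (forall n, eqmod (p ^+ n) f (G n * H n)) ->
  dvdR p (G m.+1 0%N) -> dvdR p (H m.+1 0%N) ->
  exists g h, [/\ f = g * h, dvdR p (g 0%N) & dvdR p (h 0%N)].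
Proof.
move=> uU f0 GP fGH pG pH.
have nGH : ~ dvdR (p ^+ m.+1) (G m.+1 0%N * H m.+1 0%N).
  move=> dGH; apply: (@prime_elt_exp_ndvd u m) => //; rewrite -f0.
  by have := fGH m.+1 0%N; rewrite ps_coefM0 => /dvdR_subr; apply.
have [|a [c [GE npc]]] := prime_elt_valuation hR pP (a := G m.+1 0%N).
  by apply/eqP => G0; apply: nGH; rewrite G0 mul0r; exact: dvdR0.
have a0 : (0 < a)%N by case: a GE => // GE; case: npc; move: pG; rewrite GE expr0 mulr1.
(* Otherwise [p ^+ m] divides [G_0] and [p] divides [H_0], so [p ^+ m.+1] divides [f_0]. *)
have ltam : (a < m)%N.
  rewrite ltnNge; apply/negP => lema; apply: nGH; rewrite exprSr.
  by apply: dvdR_mul => //; rewrite GE; apply/dvdR_mull/dvdR_exp.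
pose x n := G n 0%N.
have xP : cpl_elt p x by exact: GP.
have xa k : (a <= k)%N -> dvdR (p ^+ a) (x k).
  move=> leak; apply: (cpl_elt_dvd (n := m.+1) xP) => //; first by lia.
  by rewrite /x GE; exact/dvdR_mull/dvdRR.
have nxa : ~ dvdR (p ^+ a.+1) (x a.+1).
  move=> /(cpl_elt_dvd (k := m.+1) xP (leqnn _)); rewrite ltnS => /(_ (ltnW ltam)).
  by rewrite /x GE exprSr [c * _]mulrC => /(dvdR_pmul2l (prime_elt_exp_neq0 pP a)).
(* [w i] pairs the coefficient of [g] in [R] with that of the unit series [U] in the completion;
   [lev n w] is [U] at level [n]. *)
pose lev n (w : nat -> R * (nat -> R)) : pser R := fun i => (w i).2 n.
pose Q k (w : nat -> R * (nat -> R)) := [/\ cpl_elt p (w k).2,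
  k = 0%N -> (w k).1 = p ^+ a & forall n, dvdR (p ^+ n) ((w k).1 - (G n * lev n w) k)].
have [| |w wP] := @course_of_values_choice _ (0, fun=> 0) Q.
- move=> k w w' eww [wk w0 wG]; split; rewrite -eww // => n.
  rewrite -(_ : (G n * lev n w) k = (G n * lev n w') k) //.
  by apply: ps_mul_ext => // i leik; rewrite /lev eww.
- move=> k w IH.
  pose s n := \sum_(i < k) G n i.+1 * (w (k - i.+1)%N).2 n.
  have sP : cpl_elt p s.
    apply: cpl_elt_sum => i; apply: cpl_eltM; first exact: GP.
    by have lt_ik := ltn_ord i; case: (IH (k - i.+1)%N); first lia.
  (* Density: [s a] lies in [R] and agrees with [s] modulo [p ^+ a], so [r - s] is divisible by
     [G_0]. For [k = 0] the sum is empty and [r] is prescribed. *)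
  pose r := if k == 0%N then p ^+ a else s a.
  have [||||z [zP xz]] := @cpl_div a x (fun n => r - s n) xP => //.
  + by move=> n; have -> : r - s n.+1 - (r - s n) = - (s n.+1 - s n); [ring|exact: dvdR_opp].
  + exact: xa.
  + rewrite /r /s; case: k {IH s sP r} => [|k]; first by rewrite big_ord0 subr0; exact: dvdRR.
    by rewrite subrr; exact: dvdR0.
  exists (r, z); rewrite /Q upd_same; split=> //=; first by move=> k0; rewrite /r k0.
  move=> n; rewrite ps_coefM_head /lev upd_same.
  under eq_bigr => i _ do rewrite upd_lt ?ltn_subrL ?(leq_ltn_trans _ (ltn_ord i)) //.
  rewrite -/(s n); have := dvdR_subC (xz n); congr dvdR; rewrite /x /=; ring.
pose g : pser R := fun k => (w k).1.
have g0 : g 0%N = p ^+ a by case: (wP 0%N) => _ w0 _; exact: w0.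
have gE n : eqmod (p ^+ n) g (G n * lev n w) by move=> k; case: (wP k).
have [|h fgh] := @ps_division a f g g0.
  move=> N; pose M := (N + a.+1)%N.
  (* [U_0] is prime to [p], as [p ^+ a] divides [G_0] but [p ^+ a.+1] does not divide [g_0]. Then
     [V * H] is a quotient of [f] by [g] modulo [p ^+ M]. *)
  have [|V VP] := @ps_inv_mod _ hR _ pP (lev M w) M.
    move=> pl; apply: (@prime_elt_exp_ndvd 1 a); first exact: unitr1.
    rewrite mul1r -g0; apply: (@dvdR_subr _ _ _ ((G M * lev M w) 0%N)).
      by apply: dvdR_expW (gE M 0%N); exact: leq_addl.
    by rewrite ps_coefM0 exprSr; apply: dvdR_mul => //; apply: xa; rewrite /M; lia.
  exists (V * H M); apply: (@eqmodW _ _ (p ^+ M)); first exact/dvdR_exp/leq_addr.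
  apply: eqmod_trans (fGH M) _; apply: eqmod_sym.
  apply: eqmod_trans (eqmodMr _ (gE M)) _.
  have -> : G M * lev M w * (V * H M) = lev M w * V * (G M * H M) by ring.
  by rewrite -[X in eqmod _ _ X]mul1r; exact: eqmodMr.
exists g, h; split=> //.
  by rewrite g0 -{1}[p]expr1; exact: dvdR_exp.
have : p ^+ a * h 0%N = p ^+ a * (u * p ^+ (m - a)).
  by rewrite -g0 -ps_coefM0 -fgh f0 g0 mulrCA -exprD subnKC // ltnW.
move=> /(mulfI (prime_elt_exp_neq0 pP a)) ->; apply: dvdR_mull.
by rewrite -{1}[p]expr1; apply: dvdR_exp; rewrite subn_gt0.
Qed.

End Descent.

(** * The case of zero constant term, and the equivalence *)

Lemma ps_irreducible_coef0 (R : idomainType) (f : pser R) : f 0%N = 0 ->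
  ps_irreducible f <-> f 1%N \is a GRing.unit.
Proof.
move=> f0; split=> [[_ _ irr]|f1].
  (* [X] is a nonunit factor of [f], so the cofactor, whose constant term is [f_1], must be a
     unit. *)
  pose X : pser R := fun k => (k == 1%N)%:R.
  have fE k : f k = ps_mul X (ps_shift 1 f) k.
    rewrite -[ps_mul _ _]/(X * ps_shift 1 f) ps_coefM_head /X /= mul0r add0r.
    case: k => [|k]; first by rewrite big_ord0.
    rewrite big_ord_recl mul1r big1 ?addr0 => [|i _]; last by rewrite mul0r.
    by rewrite /ps_shift subn1 add1n.
  by case: (irr _ _ fE) => /ps_unitP //; rewrite /X /= unitr0.
split.
- by exists 1%N; apply: contraTneq f1 => ->; rewrite unitr0.
- by move=> /ps_unitP; rewrite f0 unitr0.
move=> g h fE; have f0E := fE 0%N; have f1E := fE 1%N.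
rewrite f0 /ps_mul big_ord1 in f0E.
rewrite /ps_mul big_ord_recl big_ord1 /= subn0 in f1E.
move/esym/eqP: f0E; rewrite mulf_eq0 => /orP[/eqP g0|/eqP h0]; [right|left]; apply/ps_unitP.
  by move: f1; rewrite f1E g0 mul0r add0r unitrM => /andP[].
by move: f1; rewrite f1E h0 mulr0 addr0 unitrM => /andP[].
Qed.

Theorem theorem1p1 (R : idomainType) (hR : PID R) (f : {poly R}) :
  ps_irreducible (ps_of_poly f) <->
  ((f`_0 = 0 /\ f`_1 \is a GRing.unit) \/
   (exists (pi : R) (m : nat),
      [/\ prime_elt pi, (1 <= m)%N,
          (exists u : R, u \is a GRing.unit /\ f`_0 = u * pi ^+ m) &
          forall g h : cpoly R,
            cpoly_elt pi g -> cpoly_elt pi h -> cpoly_factor pi f g h ->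
            cpl_unit pi (ccoef g 0) \/ cpl_unit pi (ccoef h 0)])).
Proof.
split=> [irr|[[f0 f1]|[p [m [pP m1 [u [uU f0]] fP]]]]]; last 2 first.
- exact/ps_irreducible_coef0.
- have pf : dvdR p f`_0.
    by rewrite f0; apply: dvdR_mull; rewrite -{1}[p]expr1; exact: dvdR_exp.
  split.
  + exists 0%N; rewrite /ps_of_poly f0 mulf_eq0 negb_or prime_elt_exp_neq0 // andbT.
    by apply: contraTneq uU => ->; rewrite unitr0.
  + by move=> /ps_unitP; apply/negP; exact: prime_elt_dvd_nunit pf.
  move=> g h /funext fgh; apply: contrapT => /not_orP[gU hU].
  (* A constant term prime to [p] would be a unit, since it divides [u * p ^+ m]. *)
  have gh0 : g 0%N * h 0%N = u * p ^+ m by rewrite -f0 -ps_coefM0 -[g * h]fgh.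
  have [||G [H [GP HP fGH nG nH]]] := @ps_factor_cpoly _ hR p pP f g h fgh.
  + apply: contrapT => npg; apply/gU/ps_unitP; exact: (prime_elt_pow_factor hR pP uU gh0 npg).
  + apply: contrapT => nph; apply/hU/ps_unitP.
    by apply: (prime_elt_pow_factor hR pP (y := g 0%N) uU _ nph); rewrite mulrC gh0.
  + by case: (fP G H GP HP fGH).
have [f0|f0] := eqVneq f`_0 0.
  by left; split=> //; apply/(@ps_irreducible_coef0 _ (ps_of_poly f)).
right; case: irr => _ nfU irr.
have f0U : f`_0 \isn't a GRing.unit by apply/negP => fU; apply/nfU/ps_unitP.
have [p [pP pf]] := PID_prime_divisor hR f0 f0U.
have [m [c [fE npc]]] := prime_elt_valuation hR pP f0.
have m0 : (0 < m)%N by case: m fE => // fE; case: npc; move: pf; rewrite fE expr0 mulr1.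
have pnU : ~ p ^+ m \is a GRing.unit.
  by apply/negP/(prime_elt_dvd_nunit pP); rewrite -{1}[p]expr1; exact: dvdR_exp.
have irr' (g h : pser R) : ps_of_poly f = g * h ->
    g 0%N \is a GRing.unit \/ h 0%N \is a GRing.unit.
  move=> fgh; case: (irr g h); [by move=> k; rewrite fgh| |] => /ps_unitP; by [left|right].
(* [c] and [p ^+ m] generate the unit ideal; lifting [f_0 = c * p ^+ m] makes one of them a unit,
   and [p ^+ m] is not. *)
have cU : c \is a GRing.unit.
  have [y [t yt]] := prime_elt_inv_mod hR pP m npc.
  have [||g [h [fgh g0 h0]]] := @ps_coprime_factor _ (ps_of_poly f) c (p ^+ m) y (- t).
  + exact: fE.
  + by rewrite mulNr -yt; ring.
  by case: (irr' _ _ fgh); rewrite ?g0 ?h0.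
exists p, m; split=> //; first by exists c.
move=> G H GP HP fGH.
have ccoefP K i : cpoly_elt p K -> cpl_elt p (ccoef K i).
  move=> KP; case: (ltnP i (size K)) => [/KP//|gei] n.
  by rewrite /ccoef nth_default // subrr; exact: dvdR0.
apply: contrapT => /not_orP[GU HU].
(* Level [m.+1] is where [ps_factor_descent] reads divisibility by [p]. *)
have nU K : cpoly_elt p K -> ~ cpl_unit p (ccoef K 0) -> dvdR p (ccoef K 0 m.+1).
  move=> KP KU; apply: contrapT => npK; apply: KU.
  by apply: (cpl_unitP hR pP _ _ npK) => //; exact: ccoefP.
have [||||g [h [fgh pg ph]]] := @ps_factor_descent _ hR p pP (ps_of_poly f) c m
  (fun n i => ccoef G i n) (fun n i => ccoef H i n) cU fE => //.
- by move=> i; exact: ccoefP.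
- by move=> n k; exact: fGH.
- exact: nU.
- exact: nU.
by case: (irr' _ _ fgh); apply/negP/(prime_elt_dvd_nunit pP).
Qed.
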